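(* Let $W=\mathrm{Span}_{\mathbb{R}}\{e_1,u,v\}\subset\mathbb{V}_7$ with $u,v\in V_0$ orthonormal, and set $t:=\omega_0(u,v)\in[-1,1]$. Then $(W,\veebar_7)$ is an algebra isomorphic to the twisted Vidinli algebra $\mathcal{V}_{|t|}$. In particular: (i) $W\cong\mathbb{V}_3$ if and only if $|t|=1$, equivalently $v=\pm Ju$; (ii) for $0<|t|<1$, $W\cong\mathcal{V}_{|t|}$, which is not isomorphic to $\mathbb{V}_3$; (iii) $W\cong\mathcal{VJ}_3$ if and only if $t=0$, equivalently $u$ and $v$ are $\omega_0$-orthogonal. As $u$ and $v$ range over all orthonormal pairs in $V_0$, the restrictions $(W,\veebar_7)$ realize the complete family $\{\mathcal{V}_t\}_{0\le t\le 1}$ inside $\mathbb{V}_7$ (up to isomorphism).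
   Context: Let $\{e_1,\dots,e_7\}$ be the standard orthonormal basis of $\mathbb{R}^7$ with Euclidean inner product $\langle\cdot,\cdot\rangle$, dual basis $\omega^1,\dots,\omega^7$, and $\omega^{ijk}=\omega^i\wedge\omega^j\wedge\omega^k$. Let $$\Phi=\omega^{123}+\omega^{145}+\omega^{167}+\omega^{246}-\omega^{257}-\omega^{347}-\omega^{356},$$ and let $\times$ be the bilinear cross product on $\mathbb{R}^7$ characterized by $\langle u\times v,w\rangle=\Phi(u,v,w)$. The exceptional Vidinli algebra $\mathbb{V}_7=(\mathbb{R}^7,\veebar_7)$ has the bilinear product $$a\veebar_7 b=\langle a,e_1\rangle b+\langle b,e_1\rangle a-\langle a,b\rangle e_1+\langle e_1,a\times b\rangle e_1 .$$ Here $V_0=e_1^\perp\subset\mathbb{R}^7$, $\omega_0(u,v)=\langle e_1,u\times v\rangle$ on $V_0$, and $J:V_0\to V_0$ is the linear map with $J(e_{2k})=e_{2k+1}$, $J(e_{2k+1})=-e_{2k}$ for $k=1,2,3$ (so $J^2=-\mathrm{Id}$ and $\omega_0(u,v)=\langle Ju,v\rangle$). For $T\in\mathbb{R}$ the twisted Vidinli algebra $\mathcal{V}_T=(\mathbb{R}^3,\ast_T)$ has the product $$a\ast_T b=\langle a,e_1\rangle b+\langle b,e_1\rangle a-\langle a,b\rangle e_1+T\,\langle e_1,a\times b\rangle e_1,$$ where on $\mathbb{R}^3$ one uses the standard orthonormal basis $e_1,e_2,e_3$, the Euclidean inner product and the standard cross product (with $e_2\times e_3=e_1$). The Vidinli algebra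 is $\mathbb{V}_3=\mathcal{V}_1$, and $\mathcal{VJ}_3=\mathcal{V}_0$, i.e. $\mathbb{R}^3$ with the product $\langle a,e_1\rangle b+\langle b,e_1\rangle a-\langle a,b\rangle e_1$. All isomorphisms are of $\mathbb{R}$-algebras. *)

(* Defs.v *)
From HB Require Import structures.
From mathcomp Require Import all_boot all_order all_algebra.
From mathcomp Require Import reals ring.

Set Implicit Arguments.
Unset Strict Implicit.
Unset Printing Implicit Defensive.

Import Order.TTheory GRing.Theory Num.Theory.
Local Open Scope ring_scope.

(* Basis vectors and coordinates carry the 1-based indices 1 <= i <= n.+1;
   an index outside this range is a junk value. *)
Definition e {R : realType} {n : nat} (i : nat) : 'rV[R]_n.+1 :=
  delta_mx 0 (inord i.-1).
Arguments e {R n} i%_N.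

Definition coord {R : realType} {n : nat} (i : nat) (u : 'rV[R]_n.+1) : R :=
  u 0 (inord i.-1).
Arguments coord {R n} i%_N u.

Definition dotp {R : realType} {n : nat} (u v : 'rV[R]_n) : R :=
  \sum_(i < n) u 0 i * v 0 i.

(* The wedge of three covectors with the determinant normalization, so that
   omega^{ijk}(e_i, e_j, e_k) = 1 for distinct i, j, k. *)
Definition omega3 {R : realType} {n : nat} (i j k : nat)
    (u v w : 'rV[R]_n.+1) : R :=
  \det (\matrix_(r < 3, c < 3)
          coord (nth 0%N [:: i; j; k] c) (nth 0 [:: u; v; w] r)).
Arguments omega3 {R n} (i j k)%_N u v w.

Definition Phi {R : realType} (u v w : 'rV[R]_7) : R :=
  omega3 1 2 3 u v w + omega3 1 4 5 u v w + omega3 1 6 7 u v w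
  + omega3 2 4 6 u v w - omega3 2 5 7 u v w - omega3 3 4 7 u v w
  - omega3 3 5 6 u v w.

(* Characterized by <u x v, w> = Phi(u, v, w), see [dotp_cross7]. *)
Definition cross7 {R : realType} (u v : 'rV[R]_7) : 'rV[R]_7 :=
  \row_k Phi u v (delta_mx 0 k).

Definition veebar7 {R : realType} (a b : 'rV[R]_7) : 'rV[R]_7 :=
  dotp a (e 1) *: b + dotp b (e 1) *: a - dotp a b *: e 1
  + dotp (e 1) (cross7 a b) *: e 1.

Definition V0 {R : realType} : {pred 'rV[R]_7} := [pred u | dotp (e 1) u == 0].

Definition omega0 {R : realType} (u v : 'rV[R]_7) : R :=
  dotp (e 1) (cross7 u v).

Definition omega0_orthogonal {R : realType} (u v : 'rV[R]_7) : Prop :=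
  omega0 u v = 0.

(* J e_{2k} = e_{2k+1} and J e_{2k+1} = - e_{2k} on V0, extended to the whole
   of R^7 by J e_1 = 0; see [J_V0], [JK] and [omega0_J]. *)
Definition J {R : realType} (u : 'rV[R]_7) : 'rV[R]_7 :=
  \sum_(1 <= k < 4)
    (coord (2 * k) u *: e (2 * k).+1 - coord (2 * k).+1 u *: e (2 * k)).

Definition orthonormal_in_V0 {R : realType} (u v : 'rV[R]_7) : Prop :=
  [/\ u \in V0, v \in V0, dotp u u = 1, dotp v v = 1 & dotp u v = 0].

Definition cross3 {R : realType} (a b : 'rV[R]_3) : 'rV[R]_3 :=
  (coord 2 a * coord 3 b - coord 3 a * coord 2 b) *: e 1
  + (coord 3 a * coord 1 b - coord 1 a * coord 3 b) *: e 2
  + (coord 1 a * coord 2 b - coord 2 a * coord 1 b) *: e 3.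

(* The product of the twisted Vidinli algebra V_T on R^3. *)
Definition twisted_mul {R : realType} (T : R) (a b : 'rV[R]_3) : 'rV[R]_3 :=
  dotp a (e 1) *: b + dotp b (e 1) *: a - dotp a b *: e 1
  + (T * dotp (e 1) (cross3 a b)) *: e 1.

Definition V3_mul {R : realType} : 'rV[R]_3 -> 'rV[R]_3 -> 'rV[R]_3 :=
  twisted_mul 1.

Definition VJ3_mul {R : realType} : 'rV[R]_3 -> 'rV[R]_3 -> 'rV[R]_3 :=
  twisted_mul 0.

(* A possibly non-associative algebra is a module together with a product. *)
Definition alg_iso {R : realType} {A B : lmodType R}
    (mA : A -> A -> A) (mB : B -> B -> B) : Prop :=
  exists f : {linear A -> B},
    bijective f /\ {morph f : x y / mA x y >-> mB x y}.

Definition mul_closed {R : realType} {A : vectType R} (mA : A -> A -> A)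
    (W : {vspace A}) : Prop :=
  forall a b : A, a \in W -> b \in W -> mA a b \in W.

(* The restriction of a product to a subspace W; the projection onto W acts as
   the identity on products of elements of W as soon as [mul_closed mA W]. *)
Definition restr_mul {R : realType} {A : vectType R} (mA : A -> A -> A)
    (W : {vspace A}) (a b : subvs_of W) : subvs_of W :=
  vsproj W (mA (vsval a) (vsval b)).

Definition spanW {R : realType} (u v : 'rV[R]_7) : {vspace 'rV[R]_7} :=
  <<[:: e 1; u; v]>>%VS.

Definition W_mul {R : realType} (u v : 'rV[R]_7) :
    subvs_of (spanW u v) -> subvs_of (spanW u v) -> subvs_of (spanW u v) :=
  restr_mul veebar7 (W := spanW u v).
Arguments W_mul {R} u v _ _.


Lemma omega3E (R : realType) n i j k (u v w : 'rV[R]_n.+1) :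
  omega3 i j k u v w =
    coord i u * (coord j v * coord k w - coord k v * coord j w)
    - coord j u * (coord i v * coord k w - coord k v * coord i w)
    + coord k u * (coord i v * coord j w - coord j v * coord i w).
Proof.
have d2 (A : 'M[R]_2) : \det A = A ord0 ord0 * A (lift ord0 ord0) (lift ord0 ord0)
    - A ord0 (lift ord0 ord0) * A (lift ord0 ord0) ord0.
  rewrite (expand_det_row _ ord0) !big_ord_recl big_ord0 addr0.
  rewrite /cofactor !det_mx11 !mxE /= /bump /= expr0 expr1.
  have -> : lift (lift ord0 ord0) ord0 = ord0 :> 'I_2 by apply/val_inj.
  by ring.
rewrite /omega3 (expand_det_row _ ord0) !big_ord_recl big_ord0 addr0.
rewrite /cofactor !d2 !mxE /=.
by rewrite /bump /= expr0 !expr1 expr2 !mulN1r opprK !mul1r; ring.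
Qed.

Lemma coord_sum (R : realType) n i (w : 'rV[R]_n.+1) :
  coord i w = \sum_k w 0 k * coord i (delta_mx 0 k : 'rV[R]_n.+1).
Proof.
rewrite (bigD1 (inord i.-1)) //= /coord mxE !eqxx mulr1 big1 ?addr0 // => k nk.
by rewrite mxE eq_sym (negbTE nk) mulr0.
Qed.

Lemma omega3_sum (R : realType) n i j k (u v w : 'rV[R]_n.+1) :
  omega3 i j k u v w = \sum_l w 0 l * omega3 i j k u v (delta_mx 0 l).
Proof.
rewrite omega3E (coord_sum i w) (coord_sum j w) (coord_sum k w).
rewrite !mulr_sumr -!sumrB !mulr_sumr -sumrB -big_split /=.
by apply: eq_bigr => l _; rewrite omega3E; ring.
Qed.

Lemma dotp_cross7 (R : realType) (u v w : 'rV[R]_7) :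
  dotp (cross7 u v) w = Phi u v w.
Proof.
rewrite /Phi !(omega3_sum _ _ _ u v w) -!sumrN -!big_split /=.
apply: eq_bigr => l _; rewrite mxE /Phi !mulrDl !mulNr.
by rewrite ![omega3 _ _ _ _ _ _ * _]mulrC.
Qed.

Lemma coord_e (R : realType) n i j : (0 < i <= n.+1)%N -> (0 < j <= n.+1)%N ->
  coord i (e j : 'rV[R]_n.+1) = (i == j)%:R.
Proof.
case: i j => [|i] [|j] //= ilt jlt; rewrite /coord mxE eqxx /= -val_eqE /=.
by rewrite !inordK.
Qed.

Lemma dotpE (R : realType) (u v : 'rV[R]_7) :
  dotp u v = \sum_(1 <= i < 8) coord i u * coord i v.
Proof.
rewrite big_add1 big_mkord; apply: eq_bigr => i _.
by rewrite /coord /= inord_val.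
Qed.

Lemma coordJ (R : realType) i (u : 'rV[R]_7) : (0 < i < 8)%N ->
  coord i (J u) =
    nth 0 [:: 0; - coord 3 u; coord 2 u; - coord 5 u; coord 4 u;
              - coord 7 u; coord 6 u] i.-1.
Proof.
move=> ilt.
have D (x y : 'rV[R]_7) : coord i (x + y) = coord i x + coord i y.
  by rewrite /coord mxE.
have N (x : 'rV[R]_7) : coord i (- x) = - coord i x by rewrite /coord mxE.
have Z a (x : 'rV[R]_7) : coord i (a *: x) = a * coord i x.
  by rewrite /coord mxE.
rewrite /J unlock /= !D ?N !Z !coord_e //.
have -> : coord i (0 : 'rV[R]_7) = 0 by rewrite /coord mxE.
by move: i ilt {D N Z} => [|[|[|[|[|[|[|[|]]]]]]]] //= _; ring.
Qed.

Lemma J_V0 (R : realType) (u : 'rV[R]_7) : J u \in V0.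
Proof.
by rewrite inE dotpE unlock /= !coordJ // !coord_e //=; apply/eqP; ring.
Qed.

Lemma JK (R : realType) (u : 'rV[R]_7) : u \in V0 -> J (J u) = - u.
Proof.
rewrite inE dotpE unlock /= !coord_e //= => /eqP u1; apply/rowP => k.
have E (x : 'rV[R]_7) : x 0 k = coord k.+1 x by rewrite /coord inord_val.
rewrite [(- u) 0 k]mxE !E coordJ; last exact: (ltn_ord k).
rewrite !coordJ //.
have {}u1 : coord 1 u = 0 by rewrite -u1; ring.
by case: k {E} => [[|[|[|[|[|[|[|]]]]]]] klt] //=; rewrite u1 oppr0.
Qed.

Lemma omega0_J (R : realType) (u v : 'rV[R]_7) : omega0 u v = dotp (J u) v.
Proof.
have dotpC (x y : 'rV[R]_7) : dotp x y = dotp y x.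
  by apply: eq_bigr => k _; rewrite mulrC.
rewrite /omega0 dotpC dotp_cross7 /Phi !omega3E dotpE unlock /= !coordJ //.
by rewrite !coord_e //=; ring.
Qed.

(* Main.v *)
Require Import Defs.
From HB Require Import structures.
From mathcomp Require Import all_boot all_order all_algebra.
From mathcomp Require Import reals ring lra.

Set Implicit Arguments.
Unset Strict Implicit.
Unset Printing Implicit Defensive.

Import Order.TTheory GRing.Theory Num.Theory.
Local Open Scope ring_scope.

(** The cross product enters the product of [V_7] only through the component
    [<e_1, a x b>], that is through the 2-form [omega0], and [omega0 u v] is
    [<J u, v>] where [J] is an isometry of [V0].  For an orthonormal pair
    [(u, v)] in [V0] the map [x |-> x_1 e_1 + x_2 u + x_3 v] is an isometry of
    R^3 onto [W] which fixes [e_1], and it pulls [omega0] back to [omega0 u v]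
    times the area form [x_2 y_3 - x_3 y_2] ([omega0_embed]).  All terms of the
    two products then agree, so this map is an isomorphism from the twisted
    algebra with parameter [t = omega0 u v] onto [W] ([W_iso_twisted]).  The
    reflection [e_3 |-> - e_3] reverses the area form, which turns [t] into
    [- t] and hence into [`|t|] ([twisted_iso_norm]).

    The parameter is an isomorphism invariant up to sign
    ([twisted_iso_eq_norm]).  An isomorphism fixes the unit [e_1], hence sends
    [e_2] and [e_3] to elements [p] and [q] with square [- e_1].  These relations
    and the anticommutation of [p] and [q] force [p], [q] to be an orthonormal
    pair of the plane orthogonal to [e_1].  The area of such a pair is [1] or
    [-1], while [p * q] is [e_1] times the parameter times this area.

    The two extreme cases of [-1 <= t <= 1] come from expanding
    [`|v - J u|^2 = 2 - 2 t] and [`|v + J u|^2 = 2 + 2 t].  Every value [s] in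
    [[0, 1]] is attained by [u = e_2] and [v = s e_3 + sqrt (1 - s^2) e_4], as
    [J e_2 = e_3]. *)

(** * Isomorphisms of algebras *)

Lemma alg_iso_of_linear (R : realType) (A B : lmodType R)
    (mA : A -> A -> A) (mB : B -> B -> B) (f : A -> B) :
  linear f -> bijective f -> {morph f : x y / mA x y >-> mB x y} ->
  alg_iso mA mB.
Proof.
move=> f_lin f_bij fM.
pose F : {linear A -> B} := HB.pack f (GRing.isLinear.Build R A B *:%R f f_lin).
by exists F.
Qed.

Lemma alg_iso_sym (R : realType) (A B : lmodType R)
    (mA : A -> A -> A) (mB : B -> B -> B) :
  alg_iso mA mB -> alg_iso mB mA.
Proof.
move=> [f [[g fK gK] fM]]; apply: (@alg_iso_of_linear _ _ _ _ _ g).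
- exact: can2_linear fK gK.
- by exists f.
- by move=> x y; apply: (can_inj fK); rewrite fM !gK.
Qed.

Lemma alg_iso_trans (R : realType) (A B C : lmodType R)
    (mA : A -> A -> A) (mB : B -> B -> B) (mC : C -> C -> C) :
  alg_iso mA mB -> alg_iso mB mC -> alg_iso mA mC.
Proof.
move=> [f [f_bij fM]] [g [g_bij gM]].
apply: (@alg_iso_of_linear _ _ _ _ _ (g \o f)).
- by move=> a x y /=; rewrite !linearP.
- exact: bij_comp.
- by move=> x y /=; rewrite fM gM.
Qed.

(** * Coordinates and inner products *)

Lemma coordD (R : realType) n i (x y : 'rV[R]_n.+1) :
  Defs.coord i (x + y) = Defs.coord i x + Defs.coord i y.
Proof. by rewrite /Defs.coord mxE. Qed.

Lemma coordN (R : realType) n i (x : 'rV[R]_n.+1) :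
  Defs.coord i (- x) = - Defs.coord i x.
Proof. by rewrite /Defs.coord mxE. Qed.

Lemma coordZ (R : realType) n i a (x : 'rV[R]_n.+1) :
  Defs.coord i (a *: x) = a * Defs.coord i x.
Proof. by rewrite /Defs.coord mxE. Qed.

Lemma dotpC (R : realType) n (x y : 'rV[R]_n) : dotp x y = dotp y x.
Proof. by apply: eq_bigr => i _; rewrite mulrC. Qed.

Lemma dotpDl (R : realType) n (x y z : 'rV[R]_n) :
  dotp (x + y) z = dotp x z + dotp y z.
Proof. by rewrite -big_split; apply: eq_bigr => i _; rewrite mxE mulrDl. Qed.

Lemma dotpZl (R : realType) n a (x y : 'rV[R]_n) :
  dotp (a *: x) y = a * dotp x y.
Proof. by rewrite mulr_sumr; apply: eq_bigr => i _; rewrite mxE mulrA. Qed.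

Lemma dotpNl (R : realType) n (x y : 'rV[R]_n) : dotp (- x) y = - dotp x y.
Proof. by rewrite -scaleN1r dotpZl mulN1r. Qed.

Lemma dotpDr (R : realType) n (x y z : 'rV[R]_n) :
  dotp z (x + y) = dotp z x + dotp z y.
Proof. by rewrite dotpC dotpDl !(dotpC z). Qed.

Lemma dotpZr (R : realType) n a (x y : 'rV[R]_n) :
  dotp x (a *: y) = a * dotp x y.
Proof. by rewrite dotpC dotpZl dotpC. Qed.

Lemma dotpNr (R : realType) n (x y : 'rV[R]_n) : dotp x (- y) = - dotp x y.
Proof. by rewrite dotpC dotpNl dotpC. Qed.

Lemma dotp_ge0 (R : realType) n (x : 'rV[R]_n) : 0 <= dotp x x.
Proof. by apply: sumr_ge0 => i _; rewrite -expr2 sqr_ge0. Qed.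

Lemma dotp_eq0 (R : realType) n (x : 'rV[R]_n) : dotp x x = 0 -> x = 0.
Proof.
move=> /eqP; rewrite psumr_eq0 => [|i _]; last by rewrite -expr2 sqr_ge0.
move=> /allP x0; apply/rowP => i; rewrite mxE; apply/eqP.
by have := x0 i (mem_index_enum i); rewrite mulf_eq0 orbb.
Qed.

Lemma dotp_e1l (R : realType) (x : 'rV[R]_7) : dotp (e 1) x = Defs.coord 1 x.
Proof. by rewrite dotpE unlock /= !coord_e //=; ring. Qed.

Lemma dotp3E (R : realType) (x y : 'rV[R]_3) :
  dotp x y = Defs.coord 1 x * Defs.coord 1 y + Defs.coord 2 x * Defs.coord 2 y
             + Defs.coord 3 x * Defs.coord 3 y.
Proof.
rewrite /dotp (eq_bigr (fun i : 'I_3 =>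
  Defs.coord i.+1 x * Defs.coord i.+1 y)); last first.
  by move=> i _; rewrite /Defs.coord inord_val.
by rewrite !big_ord_recl big_ord0 addr0 addrA.
Qed.

Lemma coord3_inj (R : realType) (x y : 'rV[R]_3) :
  Defs.coord 1 x = Defs.coord 1 y -> Defs.coord 2 x = Defs.coord 2 y ->
  Defs.coord 3 x = Defs.coord 3 y -> x = y.
Proof.
move=> x1 x2 x3; apply/rowP => i.
have E (z : 'rV[R]_3) : z 0 i = Defs.coord i.+1 z by rewrite /Defs.coord inord_val.
by rewrite !E; case: i {E} => [[|[|[|]]]].
Qed.

(** * The twisted algebras *)

Lemma coord1_twisted (R : realType) (T : R) (p q : 'rV[R]_3) :
  Defs.coord 1 (twisted_mul T p q) =
    Defs.coord 1 p * Defs.coord 1 q - Defs.coord 2 p * Defs.coord 2 q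
    - Defs.coord 3 p * Defs.coord 3 q
    + T * (Defs.coord 2 p * Defs.coord 3 q - Defs.coord 3 p * Defs.coord 2 q).
Proof.
by rewrite /twisted_mul /cross3 !dotp3E !(coordD, coordN, coordZ) !coord_e //=;
  ring.
Qed.

Lemma coord2_twisted (R : realType) (T : R) (p q : 'rV[R]_3) :
  Defs.coord 2 (twisted_mul T p q) =
    Defs.coord 1 p * Defs.coord 2 q + Defs.coord 1 q * Defs.coord 2 p.
Proof.
by rewrite /twisted_mul !dotp3E !(coordD, coordN, coordZ) !coord_e //=; ring.
Qed.

Lemma coord3_twisted (R : realType) (T : R) (p q : 'rV[R]_3) :
  Defs.coord 3 (twisted_mul T p q) =
    Defs.coord 1 p * Defs.coord 3 q + Defs.coord 1 q * Defs.coord 3 p.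
Proof.
by rewrite /twisted_mul !dotp3E !(coordD, coordN, coordZ) !coord_e //=; ring.
Qed.

Definition coord_twistedE :=
  (coord1_twisted, coord2_twisted, coord3_twisted).

Lemma twisted_mul1l (R : realType) (T : R) (x : 'rV[R]_3) :
  twisted_mul T (e 1) x = x.
Proof. by apply: coord3_inj; rewrite coord_twistedE !coord_e //=; ring. Qed.

Lemma twisted_mul1r (R : realType) (T : R) (x : 'rV[R]_3) :
  twisted_mul T x (e 1) = x.
Proof. by apply: coord3_inj; rewrite coord_twistedE !coord_e //=; ring. Qed.

(** If [p_1] were nonzero, [p * p] being a multiple of [e_1] would make [p] a
    real multiple of the unit, whose square cannot be negative. *)
Lemma twisted_sqr_eqN1 (R : realType) (T : R) (p : 'rV[R]_3) :
  twisted_mul T p p = - e 1 ->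
  Defs.coord 1 p = 0 /\ Defs.coord 2 p ^+ 2 + Defs.coord 3 p ^+ 2 = 1.
Proof.
move=> pp.
have := congr1 (Defs.coord 1) pp; have := congr1 (Defs.coord 2) pp.
have := congr1 (Defs.coord 3) pp; rewrite !coord_twistedE !coordN !coord_e //=.
set a := Defs.coord 1 p; set b := Defs.coord 2 p; set c := Defs.coord 3 p.
move=> c0 b0 a1.
have [a0|a_neq0] := eqVneq a 0; first by split=> //; move: a1; rewrite a0; lra.
have half z : a * z + a * z = - 0 -> z = 0.
  move=> h; apply: (mulfI a_neq0); lra.
have := sqr_ge0 a; move: a1; rewrite (half b b0) (half c c0); lra.
Qed.

(** The structure constant [S] of the images [p], [q] of [e_2], [e_3] is [T]
    times their area, and the area squared is the Gram determinant [1]. *)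
Lemma twisted_iso_eq_norm (R : realType) (S T : R) :
  alg_iso (twisted_mul S) (twisted_mul T) -> `|S| = `|T|.
Proof.
move=> [f [[g fK gK] fM]].
have f1 : f (e 1) = e 1.
  by rewrite -[LHS](twisted_mul1r T) -[X in twisted_mul _ _ X]gK -fM
             twisted_mul1l gK.
have pp : twisted_mul T (f (e 2)) (f (e 2)) = - e 1.
  rewrite -fM -f1 -linearN; congr (f _).
  by apply: coord3_inj; rewrite coord_twistedE coordN !coord_e //=; ring.
have qq : twisted_mul T (f (e 3)) (f (e 3)) = - e 1.
  rewrite -fM -f1 -linearN; congr (f _).
  by apply: coord3_inj; rewrite coord_twistedE coordN !coord_e //=; ring.
have pq : twisted_mul T (f (e 2)) (f (e 3)) = S *: e 1.
  rewrite -fM -f1 -linearZ; congr (f _).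
  by apply: coord3_inj; rewrite coord_twistedE coordZ !coord_e //=; ring.
have qp : twisted_mul T (f (e 3)) (f (e 2)) = - S *: e 1.
  rewrite -fM -f1 -linearZ; congr (f _).
  by apply: coord3_inj; rewrite coord_twistedE coordZ !coord_e //=; ring.
have [p1 pn] := twisted_sqr_eqN1 pp; have [q1 qn] := twisted_sqr_eqN1 qq.
have := congr1 (Defs.coord 1) pq; have := congr1 (Defs.coord 1) qp.
rewrite !coord_twistedE !coordZ !coord_e //= p1 q1.
move: pn qn; set a := Defs.coord 2 _; set b := Defs.coord 3 _.
set c := Defs.coord 2 _; set d := Defs.coord 3 _ => pn qn qpS pqS.
have S_area : S = T * (a * d - b * c) by lra.
have ort : a * c + b * d = 0 by lra.
have area1 : (a * d - b * c) ^+ 2 = 1.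
  have -> : (a * d - b * c) ^+ 2 =
    (a ^+ 2 + b ^+ 2) * (c ^+ 2 + d ^+ 2) - (a * c + b * d) ^+ 2 by ring.
  by rewrite pn qn ort; ring.
by rewrite -!sqrtr_sqr S_area exprMn area1 mulr1.
Qed.

Lemma twisted_iso_opp (R : realType) (T : R) :
  alg_iso (twisted_mul T) (twisted_mul (- T)).
Proof.
pose f (x : 'rV[R]_3) : 'rV[R]_3 :=
  Defs.coord 1 x *: e 1 + Defs.coord 2 x *: e 2 - Defs.coord 3 x *: e 3.
have f1 x : Defs.coord 1 (f x) = Defs.coord 1 x.
  by rewrite !(coordD, coordN, coordZ) !coord_e //=; ring.
have f2 x : Defs.coord 2 (f x) = Defs.coord 2 x.
  by rewrite !(coordD, coordN, coordZ) !coord_e //=; ring.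
have f3 x : Defs.coord 3 (f x) = - Defs.coord 3 x.
  by rewrite !(coordD, coordN, coordZ) !coord_e //=; ring.
clearbody f.
have fK : involutive f.
  by move=> x; apply: coord3_inj; rewrite !(f1, f2, f3) ?opprK.
apply: (@alg_iso_of_linear _ _ _ _ _ f); last 2 first.
- by exists f.
- move=> x y; apply: coord3_inj;
    by rewrite !(f1, f2, f3) !coord_twistedE !(f1, f2, f3); ring.
move=> a x y; apply: coord3_inj;
  by rewrite !(coordD, coordZ, f1, f2, f3); ring.
Qed.

Lemma twisted_iso_norm (R : realType) (T : R) :
  alg_iso (twisted_mul T) (twisted_mul `|T|).
Proof.
case: (ger0P T) => _; last exact: twisted_iso_opp.
by apply: (@alg_iso_of_linear _ _ _ _ _ id) => //; exists id.
Qed.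

(** * The form omega0 and the isometry J *)

Lemma omega0E (R : realType) (x y : 'rV[R]_7) :
  omega0 x y =
    (Defs.coord 2 x * Defs.coord 3 y - Defs.coord 3 x * Defs.coord 2 y)
    + (Defs.coord 4 x * Defs.coord 5 y - Defs.coord 5 x * Defs.coord 4 y)
    + (Defs.coord 6 x * Defs.coord 7 y - Defs.coord 7 x * Defs.coord 6 y).
Proof. by rewrite omega0_J dotpE unlock /= !coordJ //=; ring. Qed.

Lemma dotp_JJ (R : realType) (x : 'rV[R]_7) :
  x \in V0 -> dotp (J x) (J x) = dotp x x.
Proof.
rewrite inE dotp_e1l => /eqP x1.
by rewrite !dotpE unlock /= !coordJ //= x1; ring.
Qed.

(** This is [<v, v> + s^2 <J u, J u> + 2 s <J u, v>] for [s = 1] or [s = -1]. *)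
Lemma sqr_norm_addJ (R : realType) (u v : 'rV[R]_7) (s : R) :
  orthonormal_in_V0 u v -> s ^+ 2 = 1 ->
  dotp (v + s *: J u) (v + s *: J u) = 2 + 2 * s * omega0 u v.
Proof.
move=> [u0 _ uu vv _] s1.
rewrite !(dotpDl, dotpDr, dotpZl, dotpZr) (dotpC v (J u)) dotp_JJ // uu vv.
by rewrite omega0_J mulr1 -expr2 s1; ring.
Qed.

Lemma omega0_bounds (R : realType) (u v : 'rV[R]_7) :
  orthonormal_in_V0 u v -> -1 <= omega0 u v <= 1.
Proof.
move=> uv.
have := dotp_ge0 (v + 1 *: J u); rewrite (sqr_norm_addJ uv) ?expr1n //.
have := dotp_ge0 (v + (-1) *: J u); rewrite (sqr_norm_addJ uv) ?sqrrN ?expr1n //.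
by move=> ? ?; apply/andP; split; lra.
Qed.

Lemma norm_omega0_eq1 (R : realType) (u v : 'rV[R]_7) :
  orthonormal_in_V0 u v -> `|omega0 u v| = 1 <-> v = J u \/ v = - J u.
Proof.
move=> uv; split=> [t1|]; last first.
  have [u0 _ uu _ _] := uv.
  by case=> ->; rewrite omega0_J ?dotpNr dotp_JJ // uu ?normrN normr1.
have /eqP := t1; rewrite eqr_norml ler01 andbT => /orP[] /eqP t_pm1.
- left; apply/eqP; rewrite -subr_eq0 -scaleN1r; apply/eqP/dotp_eq0.
  by rewrite (sqr_norm_addJ uv) ?sqrrN ?expr1n // t_pm1; ring.
- right; apply/eqP; rewrite -addr_eq0 -[J u]scale1r; apply/eqP/dotp_eq0.
  by rewrite (sqr_norm_addJ uv) ?expr1n // t_pm1; ring.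
Qed.

(** * The isomorphism with the subspace W *)

Definition embed (R : realType) (u v : 'rV[R]_7) (x : 'rV[R]_3) : 'rV[R]_7 :=
  Defs.coord 1 x *: e 1 + Defs.coord 2 x *: u + Defs.coord 3 x *: v.

Lemma embed_is_linear (R : realType) (u v : 'rV[R]_7) : linear (embed u v).
Proof.
move=> a x y; apply/rowP => i.
by rewrite /embed !coordD !coordZ !mxE; ring.
Qed.

HB.instance Definition _ (R : realType) (u v : 'rV[R]_7) :=
  GRing.isLinear.Build R 'rV[R]_3 'rV[R]_7 *:%R (embed u v)
    (embed_is_linear u v).

Lemma embed_e1 (R : realType) (u v : 'rV[R]_7) : embed u v (e 1) = e 1.
Proof. by rewrite /embed !coord_e //= scale1r !scale0r !addr0. Qed.

Lemma dotp_embed (R : realType) (u v : 'rV[R]_7) (x y : 'rV[R]_3) :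
  orthonormal_in_V0 u v -> dotp (embed u v x) (embed u v y) = dotp x y.
Proof.
move=> [/eqP u0 /eqP v0 uu vv uv].
rewrite /embed !(dotpDl, dotpDr, dotpZl, dotpZr) !(dotpC _ (e 1)) (dotpC v u).
by rewrite dotp3E u0 v0 uu vv uv dotp_e1l coord_e //=; ring.
Qed.

(** The form [omega0] has [e_1] in its radical, and on the plane of [u] and [v]
    it is a multiple of the only area form. *)
Lemma omega0_embed (R : realType) (u v : 'rV[R]_7) (x y : 'rV[R]_3) :
  omega0 (embed u v x) (embed u v y) =
    omega0 u v * (Defs.coord 2 x * Defs.coord 3 y - Defs.coord 3 x * Defs.coord 2 y).
Proof. by rewrite !omega0E /embed !coordD !coordZ !coord_e //=; ring. Qed.

Lemma embedM (R : realType) (u v : 'rV[R]_7) (x y : 'rV[R]_3) :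
  orthonormal_in_V0 u v ->
  embed u v (twisted_mul (omega0 u v) x y) = veebar7 (embed u v x) (embed u v y).
Proof.
move=> uv; rewrite /twisted_mul /veebar7 -/(omega0 _ _) omega0_embed.
have -> : dotp (e 1) (cross3 x y) =
    Defs.coord 2 x * Defs.coord 3 y - Defs.coord 3 x * Defs.coord 2 y.
  by rewrite /cross3 dotp3E !coordD !coordZ !coord_e //=; ring.
have embed_dotp_e1 z : dotp (embed u v z) (e 1) = dotp z (e 1).
  by rewrite -[X in dotp _ X](embed_e1 u v) dotp_embed.
have embedD : {morph embed u v : z w / z + w} by exact: linearD.
have embedN : {morph embed u v : z / - z} by exact: linearN.
have embedZ a : {morph embed u v : z / a *: z} by move=> z; exact: linearZ.
by rewrite !(embedD, embedN, embedZ) !embed_e1 !embed_dotp_e1 dotp_embed.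
Qed.

Lemma mem_embed (R : realType) (u v : 'rV[R]_7) (x : 'rV[R]_3) :
  embed u v x \in spanW u v.
Proof.
by rewrite /embed !memvD // memvZ // memv_span // !inE eqxx ?orbT.
Qed.

Lemma mem_spanW (R : realType) (u v w : 'rV[R]_7) :
  w \in spanW u v -> exists x, w = embed u v x.
Proof.
move=> /(@coord_span _ _ 3 [tuple e 1; u; v]); rewrite !big_ord_recl big_ord0 addr0 /=.
set a := coord _ _ _; set b := coord _ _ _; set c := coord _ _ _ => ->.
exists (a *: e 1 + b *: e 2 + c *: e 3).
rewrite /embed !coordD !coordZ !coord_e //=.
by rewrite !(mulr0, mulr1, addr0, add0r) addrA.
Qed.

Lemma W_mul_closed (R : realType) (u v : 'rV[R]_7) :
  orthonormal_in_V0 u v -> mul_closed veebar7 (spanW u v).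
Proof.
move=> uv a b /mem_spanW[x ->] /mem_spanW[y ->].
by rewrite -embedM // mem_embed.
Qed.

(** The map is built from R^3 to [W], where its multiplicativity is [embedM];
    as [embed] is an isometry, its inverse reads off the coordinates of a vector
    of [W] by inner products with the orthonormal basis [e_1], [u], [v]. *)
Lemma W_iso_twisted (R : realType) (u v : 'rV[R]_7) :
  orthonormal_in_V0 u v -> alg_iso (W_mul u v) (twisted_mul (omega0 u v)).
Proof.
move=> uv; apply: alg_iso_sym.
pose f x := vsproj (spanW u v) (embed u v x).
have valf x : vsval (f x) = embed u v x by rewrite vsprojK // mem_embed.
pose g (w : subvs_of (spanW u v)) : 'rV[R]_3 :=
  dotp (e 1) (vsval w) *: e 1 + dotp u (vsval w) *: e 2 + dotp v (vsval w) *: e 3.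
have gf : cancel f g.
  (* The basis vectors of W are images of basis vectors under the isometry. *)
  have eu : embed u v (e 2) = u.
    by rewrite /embed !coord_e //= scale1r !scale0r addr0 add0r.
  have ev : embed u v (e 3) = v.
    by rewrite /embed !coord_e //= scale1r !scale0r !add0r.
  move=> x; rewrite /g valf -[X in dotp X](embed_e1 u v).
  rewrite -[X in dotp X _ *: e 2]eu -[X in dotp X _ *: e 3]ev !dotp_embed //.
  by apply: coord3_inj; rewrite !coordD !coordZ !dotp3E !coord_e //=; ring.
apply: (@alg_iso_of_linear _ _ _ _ _ f).
- by move=> a x y; rewrite /f !linearP.
- exists g => // w; have [x wx] := mem_spanW (subvsP w).
  have -> : w = f x by rewrite /f -wx vsvalK.
  by rewrite gf.
- by move=> x y; rewrite /W_mul /restr_mul !valf -embedM.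
Qed.

Lemma W_iso_twisted_norm (R : realType) (u v : 'rV[R]_7) :
  orthonormal_in_V0 u v -> alg_iso (W_mul u v) (twisted_mul `|omega0 u v|).
Proof.
by move=> uv; apply: alg_iso_trans (W_iso_twisted uv) (twisted_iso_norm _).
Qed.

Lemma W_iso_twisted_iff (R : realType) (u v : 'rV[R]_7) (T : R) :
  orthonormal_in_V0 u v ->
  alg_iso (W_mul u v) (twisted_mul T) <-> `|omega0 u v| = `|T|.
Proof.
move=> uv; split=> [iso|tT].
  by apply: twisted_iso_eq_norm; apply: alg_iso_trans iso; apply/alg_iso_sym/W_iso_twisted.
apply: alg_iso_trans (W_iso_twisted_norm uv) _; rewrite tT.
exact/alg_iso_sym/twisted_iso_norm.
Qed.

(** The second vector is the unit vector whose component along [J e_2 = e_3] is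
    [s]; the rest of it can be put on [e_4]. *)
Lemma exists_omega0_eq (R : realType) (s : R) : 0 <= s <= 1 ->
  exists u v : 'rV[R]_7, orthonormal_in_V0 u v /\ omega0 u v = s.
Proof.
move=> /andP[s0 s1].
have r2 : Num.sqrt (1 - s ^+ 2) ^+ 2 = 1 - s ^+ 2.
  by rewrite sqr_sqrtr // subr_ge0 expr_le1.
set r := Num.sqrt _ in r2.
exists (e 2), (s *: e 3 + r *: e 4); split; last first.
  by rewrite omega0E !coordD !coordZ !coord_e //=; ring.
split; rewrite ?inE ?dotp_e1l ?dotpE ?unlock /= ?coordD ?coordZ ?coord_e //=.
- by apply/eqP; ring.
- by ring.
- by transitivity (s ^+ 2 + r ^+ 2); [ring | rewrite r2; ring].
- by ring.
Qed.

Theorem theorem3p8 (R : realType) :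
  (forall u v : 'rV[R]_7, orthonormal_in_V0 u v ->
    let t := omega0 u v in
    [/\ -1 <= t <= 1,
        mul_closed veebar7 (spanW u v)
          /\ alg_iso (W_mul u v) (twisted_mul `|t|),
        (alg_iso (W_mul u v) V3_mul <-> `|t| = 1)
          /\ (`|t| = 1 <-> v = J u \/ v = - J u),
        0 < `|t| < 1 ->
          alg_iso (W_mul u v) (twisted_mul `|t|)
          /\ ~ alg_iso (twisted_mul `|t|) V3_mul
      & (alg_iso (W_mul u v) VJ3_mul <-> t = 0)
          /\ (t = 0 <-> omega0_orthogonal u v)])
  /\ ((forall u v : 'rV[R]_7, orthonormal_in_V0 u v ->
         exists s : R, 0 <= s <= 1
           /\ alg_iso (W_mul u v) (twisted_mul s))
      /\ (forall s : R, 0 <= s <= 1 ->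
         exists u v : 'rV[R]_7, orthonormal_in_V0 u v
           /\ alg_iso (W_mul u v) (twisted_mul s))).
Proof.
split; [move=> u v uv t | split=> [u v uv | s s01]].
- split.
  + exact: omega0_bounds.
  + by split; [exact: W_mul_closed | exact: W_iso_twisted_norm].
  + split; last exact: norm_omega0_eq1.
    by rewrite -[X in _ = X]normr1; exact: W_iso_twisted_iff.
  + move=> /andP[_ t_lt1]; split; first exact: W_iso_twisted_norm.
    move=> /twisted_iso_eq_norm; rewrite normr_id normr1 => t1.
    by rewrite t1 ltxx in t_lt1.
  + split=> //; rewrite (W_iso_twisted_iff 0 uv) normr0.
    by split=> [/normr0_eq0 //|t0]; rewrite -/t t0 normr0.
- exists `|omega0 u v|; split; last exact: W_iso_twisted_norm.
  by rewrite normr_ge0 ler_norml; exact: omega0_bounds.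
- have [u [v [uv uvs]]] := exists_omega0_eq s01.
  by exists u, v; split=> //; rewrite -uvs; exact: W_iso_twisted.
Qed.
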